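(* Let $G$ be a finitely generated discrete group with no nontrivial finite normal subgroups. Then $G$ is an $\mathcal{N}(G)$-Pompeiu group; that is, for every nonempty finite subset $K\subseteq G$, the only $f\in\mathcal{N}(G)$ satisfying $\sum_{x\in gKh}f(x)=0$ for all $g,h\in G$ (equivalently $\widetilde{\chi_K}\ast L_g f=0$ for all $g\in G$) is $f=0$.
   Context: $\mathcal{N}(G)$ is the group von Neumann algebra of $G$: the weak closure of $\mathbb{C}G$ (acting on $\ell^2(G)$ by left convolution) in $\mathcal{B}(\ell^2(G))$, identified with a subspace of $\ell^2(G)$ via $T\mapsto T\chi_1$, $\chi_1$ the point mass at the identity. $\chi_K$ is the characteristic function of $K$, $\tilde u(x)=u(x^{-1})$, $L_g u(x)=u(gx)$, and $(u\ast v)(g)=\sum_{x}u(gx^{-1})v(x)$. For a class $\mathcal{C}$ of functions on $G$ containing $0$, a finite $K\subseteq G$ is a $\mathcal{C}$-Pompeiu set if $f=0$ is the only $f\in\mathcal{C}$ with $\sum_{x\in gKh}f(x)=0$ for all $g,h\in G$; $G$ is a $\mathcal{C}$-Pompeiu group if every nonempty finite subset is a $\mathcal{C}$-Pompeiu set. *)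

(* Defs.v *)
From Stdlib Require Import Reals List ClassicalEpsilon.
From Coquelicot Require Import Coquelicot.
Set Implicit Arguments.
Unset Strict Implicit.

Record Group := {
  gcarrier :> Type;
  gmul : gcarrier -> gcarrier -> gcarrier;
  ginv : gcarrier -> gcarrier;
  gone : gcarrier;
  gmulA : forall x y z, gmul x (gmul y z) = gmul (gmul x y) z;
  gmul1 : forall x, gmul gone x = x;
  gmulV : forall x, gmul (ginv x) x = gone
}.

Section Defs.
Variable G : Group.

Inductive generated (S : list G) : G -> Prop :=
| gen_one : generated S (gone G)
| gen_elt s : In s S -> generated S s
| gen_inv x : generated S x -> generated S (ginv x)
| gen_mul x y : generated S x -> generated S y -> generated S (gmul x y).

Definition finitely_generated : Prop :=
  exists S : list G, forall x, generated S x.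

Definition is_subgroup (H : G -> Prop) : Prop :=
  H (gone G) /\ (forall x y, H x -> H y -> H (gmul x y)) /\
  (forall x, H x -> H (ginv x)).

Definition is_normal (H : G -> Prop) : Prop :=
  forall g x, H x -> H (gmul (gmul g x) (ginv g)).

Definition is_finite_set (H : G -> Prop) : Prop :=
  exists l : list G, forall x, H x -> In x l.

Definition no_nontrivial_finite_normal : Prop :=
  forall H : G -> Prop, is_subgroup H -> is_normal H -> is_finite_set H ->
    forall x, H x -> x = gone G.

Definition csum (a : G -> C) (F : list G) : C :=
  fold_right (fun x acc => Cplus (a x) acc) (RtoC 0) F.

Definition has_sum (a : G -> C) (s : C) : Prop :=
  forall eps : R, 0 < eps -> exists F0 : list G,
    forall F : list G, NoDup F -> incl F0 F -> Cmod (Cminus (csum a F) s) < eps.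

Definition normsq (xi : G -> C) (r : R) : Prop :=
  has_sum (fun x => RtoC (Cmod (xi x) ^ 2)) (RtoC r).
Definition ell2 (xi : G -> C) : Prop := exists r, normsq xi r.
Definition inner (xi eta : G -> C) (s : C) : Prop :=
  has_sum (fun x => Cmult (xi x) (Cconj (eta x))) s.

(* bounded linear operators on l^2(G) (only their action on l^2(G) matters) *)
Definition bounded_linear (T : (G -> C) -> (G -> C)) : Prop :=
  (forall xi, ell2 xi -> ell2 (T xi)) /\
  (forall xi eta (a b : C), ell2 xi -> ell2 eta ->
     T (fun x => Cplus (Cmult a (xi x)) (Cmult b (eta x)))
     = (fun x => Cplus (Cmult a (T xi x)) (Cmult b (T eta x)))) /\
  (exists M : R, forall xi r r', ell2 xi -> normsq xi r -> normsq (T xi) r' ->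
     r' <= M * r).

(* elements of CG: finite formal combinations sum_k c_k h_k, acting on l^2(G)
   by left convolution: (h * xi)(g) = xi(h^-1 g) *)
Definition CG := list (G * C).
Definition conv_op (a : CG) (xi : G -> C) : G -> C :=
  fun g => fold_right (fun p acc =>
     Cplus (Cmult (snd p) (xi (gmul (ginv (fst p)) g))) acc) (RtoC 0) a.

Definition VecPair : Type := prod (G -> C) (G -> C).

Definition in_wot_closure (T : (G -> C) -> (G -> C)) : Prop :=
  forall (ps : list VecPair) (eps : R), 0 < eps ->
    List.Forall (fun p : VecPair => ell2 (fst p) /\ ell2 (snd p)) ps ->
    exists a : CG, List.Forall (fun p => forall s t,
        inner (T (fst p)) (snd p) s -> inner (conv_op a (fst p)) (snd p) t ->
        Cmod (Cminus s t) < eps) ps.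

Definition chi1 : G -> C :=
  fun g => if excluded_middle_informative (g = gone G) then RtoC 1 else RtoC 0.

(* N(G), identified with a subspace of l^2(G) via T |-> T chi1 *)
Definition in_NG (f : G -> C) : Prop :=
  exists T, bounded_linear T /\ in_wot_closure T /\ f = T chi1.

(* Pompeiu sets / groups for a class of functions.  A finite set K is a
   duplicate-free list; gKh is listed as map (x |-> g x h) K (duplicate-free). *)
Definition pompeiu_set (cls : (G -> C) -> Prop) (K : list G) : Prop :=
  forall f, cls f ->
    (forall g h, csum f (map (fun k => gmul (gmul g k) h) K) = RtoC 0) ->
    f = (fun _ => RtoC 0).

Definition pompeiu_group (cls : (G -> C) -> Prop) : Prop :=
  forall K : list G, K <> nil -> NoDup K -> pompeiu_set cls K.

End Defs.

(* Main.v *)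
Require Import Defs.
From Stdlib Require Import Reals Lra Lia Arith Classical ClassicalEpsilon FinFun.
From Coquelicot Require Import Coquelicot.
From Stdlib Require Import List.

(* The functions in l^2(G) whose sums over all gKh vanish form a closed subspace V,
   invariant under left and right translations. The point p of V closest to the point
   mass at 1 is therefore a class function, so, being square summable, it is supported
   on the FC-centre D of G, and p <> 0 unless V = 0. Since G has no nontrivial finite
   normal subgroup, D is torsion-free (Dicman) and abelian (Schur). Restricting the
   equations to one coset of D gives a finite nonempty L in D with
   sum_(l in L) p(x d l) = 0 for all d in D. This is impossible for p(x) <> 0. Indeed
   let F_n be the set of products of powers of elements of L with exponents at most n.
   Using a partial order on D, the solutions restricted to F_(n+1) are determined by
   |F_(n+1)| - |F_n| of their values, while comparing the dimension with the norms of the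
   evaluations bounds it below by a fixed fraction of |F_(n+1)|; but |F_n| grows
   polynomially. *)

Declare Scope grp_scope.
Delimit Scope grp_scope with g.
Notation "x * y" := (gmul x y) : grp_scope.
Notation "x ^-1" := (ginv x) (at level 3, left associativity, format "x ^-1") : grp_scope.

Definition eq_dec_classic (A : Type) (x y : A) : {x = y} + {x <> y} :=
  excluded_middle_informative (x = y).
Arguments eq_dec_classic {A}.

(** An injective [f] would put [S (length l)] distinct values into [l]. The shift [S k] keeps the
    two indices apart, so that a repetition among powers yields a positive exponent. *)
Lemma pigeonhole (A : Type) (f : nat -> A) (l : list A) :
  (forall n, In (f n) l) -> exists i k, f i = f (i + S k)%nat.
Proof.
  intros Hf. apply NNPP. intros Hno.
  assert (Hinj : Injective f).
  { intros i j Hij. destruct (Nat.lt_trichotomy i j) as [H | [H | H]]; auto;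
      exfalso; apply Hno.
    - exists i, (j - S i)%nat. rewrite Hij. f_equal. lia.
    - exists j, (i - S j)%nat. rewrite <- Hij. f_equal. lia. }
  assert (Hlen : (length (map f (seq 0 (S (length l)))) <= length l)%nat).
  { apply NoDup_incl_length.
    - apply Injective_map_NoDup; auto. apply seq_NoDup.
    - intros x Hx. apply in_map_iff in Hx. destruct Hx as [n [<- _]]. auto. }
  rewrite length_map, length_seq in Hlen. lia.
Qed.

(** * The FC-centre *)

Section GroupTheory.
Variable G : Group.
Local Open Scope grp_scope.
Implicit Types x y z g h s : G.

Lemma gmulVK x y : x^-1 * (x * y) = y.
Proof. rewrite gmulA, gmulV, gmul1. reflexivity. Qed.

Lemma gmulI x y z : x * y = x * z -> y = z.
Proof. intros H. rewrite <- (gmulVK x y), H. apply gmulVK. Qed.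

Lemma gmul1r x : x * gone G = x.
Proof. apply (@gmulI (x^-1)). rewrite gmulVK. symmetry. apply gmulV. Qed.

Lemma gmulVr x : x * x^-1 = gone G.
Proof. apply (@gmulI (x^-1)). rewrite gmulVK, gmul1r. reflexivity. Qed.

Lemma gmulKV x y : x * (x^-1 * y) = y.
Proof. rewrite gmulA, gmulVr, gmul1. reflexivity. Qed.

Lemma ginv_unique x y : x * y = gone G -> x^-1 = y.
Proof. intros H. rewrite <- (gmul1r (x^-1)), <- H. apply gmulVK. Qed.

Lemma ginvK x : x^-1^-1 = x.
Proof. apply ginv_unique. apply gmulV. Qed.

Lemma ginvM x y : (x * y)^-1 = y^-1 * x^-1.
Proof.
  apply ginv_unique. rewrite <- gmulA, gmulKV. apply gmulVr.
Qed.

Lemma ginv1 : (gone G)^-1 = gone G.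
Proof. apply ginv_unique. apply gmul1. Qed.

Ltac grp := repeat progress (rewrite <- ?gmulA, ?ginvM, ?ginvK, ?ginv1, ?gmul1, ?gmul1r,
  ?gmulV, ?gmulVr, ?gmulVK, ?gmulKV); auto.

Lemma gmulIr x y z : y * x = z * x -> y = z.
Proof.
  intros H. rewrite <- (gmul1r y), <- (gmulVr x), gmulA, H. grp.
Qed.

(** * Powers and words *)

Fixpoint gpow x (n : nat) : G :=
  match n with O => gone G | S n => x * gpow x n end.

Lemma gpowD x m n : gpow x (m + n) = gpow x m * gpow x n.
Proof. induction m as [| m IH]; simpl; [grp |]. rewrite IH. grp. Qed.

Lemma gpowM x m n : gpow x (m * n) = gpow (gpow x n) m.
Proof. induction m as [| m IH]; simpl; auto. rewrite gpowD, IH. auto. Qed.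

Lemma gpow1 x : gpow x 1 = x.
Proof. apply gmul1r. Qed.

Lemma gpow_conj g x n : gpow (g * x * g^-1) n = g * gpow x n * g^-1.
Proof. induction n as [| n IH]; simpl; [| rewrite IH]; grp. Qed.

Lemma gpow_commute x y n : x * y = y * x -> gpow x n * y = y * gpow x n.
Proof.
  intros H. induction n as [| n IH]; simpl; [grp |].
  rewrite <- gmulA, IH, !gmulA, H. reflexivity.
Qed.

Lemma gpow_mul x y n : x * y = y * x -> gpow (x * y) n = gpow x n * gpow y n.
Proof.
  intros H. induction n as [| n IH]; simpl; [grp |].
  rewrite IH. rewrite <- !gmulA. f_equal. rewrite !gmulA. f_equal.
  symmetry. apply gpow_commute. auto.
Qed.

Lemma gpow_of_one n : gpow (gone G) n = gone G.
Proof. induction n as [| n IH]; simpl; grp. Qed.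

Definition gprod (w : list G) : G := fold_right (@gmul G) (gone G) w.

Lemma gprod_app w1 w2 : gprod (w1 ++ w2) = gprod w1 * gprod w2.
Proof. induction w1 as [| a w IH]; simpl; [| rewrite IH]; grp. Qed.

Lemma gprod_repeat x n : gprod (repeat x n) = gpow x n.
Proof. induction n as [| n IH]; simpl; [| rewrite IH]; auto. Qed.

Lemma gprod_conj g w :
  g * gprod w * g^-1 = gprod (map (fun x => g * x * g^-1) w).
Proof. induction w as [| a w IH]; simpl; [| rewrite <- IH]; grp. Qed.

Lemma count_remove s (w : list G) :
  length w = (count_occ (eq_dec_classic) w s
              + length (remove (eq_dec_classic) s w))%nat.
Proof.
  induction w as [| a w IH]; simpl; auto.
  destruct (eq_dec_classic a s), (eq_dec_classic s a); simpl; try congruence; lia.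
Qed.

(** Induction on the alphabet [l], deleting all occurrences of one letter at a time. Read
    contrapositively, a long word repeats some letter often. *)
Lemma length_le_count (l w : list G) (M : nat) :
  incl w l -> (forall s, In s l -> (count_occ (eq_dec_classic) w s <= M)%nat) ->
  (length w <= length l * M)%nat.
Proof.
  revert w. induction l as [| s l IH]; intros w Hincl Hc.
  - apply incl_l_nil in Hincl. subst w. simpl. lia.
  - rewrite (count_remove s w). simpl. apply Nat.add_le_mono; [apply Hc; simpl; auto |].
    apply IH.
    + intros x Hx. apply in_remove in Hx. destruct Hx as [Hx Hxs].
      destruct (Hincl x Hx); [congruence | auto].
    + intros x Hx. transitivity (count_occ (eq_dec_classic) w x);
        [| apply Hc; simpl; auto].
      clear. induction w as [| a w IH]; simpl; auto.
      destruct (eq_dec_classic s a); simpl; destruct (eq_dec_classic a x); lia.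
Qed.

(** Pulling [s] to the front past a letter [a] replaces [a] by a conjugate, which stays in [S] by
    normality. The number of letters is unchanged. *)
Lemma word_extract (S : G -> Prop) s (k : nat) (w : list G) :
  is_normal S -> Forall S w -> (k <= count_occ (eq_dec_classic) w s)%nat ->
  exists w', Forall S w' /\ length w = (k + length w')%nat /\
    gprod w = gpow s k * gprod w'.
Proof.
  intros HS Hw. revert k. induction Hw as [| a w Ha Hw IH]; simpl; intros k Hk.
  - exists nil. replace k with O by lia. simpl. repeat split; auto. grp.
  - destruct (eq_dec_classic a s) as [-> | Hne].
    + destruct k as [| k].
      * exists (s :: w). simpl. repeat split; auto. grp.
      * destruct (IH k) as [w' [H1 [H2 H3]]]; [lia |].
        exists w'. repeat split; auto; simpl; [lia |]. rewrite H3. grp.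
    + destruct (IH k) as [w' [H1 [H2 H3]]]; auto.
      exists ((gpow s k)^-1 * a * (gpow s k)^-1^-1 :: w'). repeat split.
      * constructor; auto.
      * simpl. lia.
      * simpl. rewrite H3. grp.
Qed.

Lemma finite_words (l : list G) (B : nat) :
  is_finite_set (fun x => exists w, incl w l /\ (length w <= B)%nat /\ x = gprod w).
Proof.
  induction B as [| B [m Hm]].
  - exists (gone G :: nil). intros x [w [_ [Hw ->]]].
    destruct w; simpl in *; auto; lia.
  - exists (gone G :: flat_map (fun a => map (fun y => a * y) m) l).
    intros x [w [Hi [Hw ->]]]. destruct w as [| a w]; simpl; auto.
    right. apply in_flat_map. exists a. split; [apply Hi; simpl; auto |].
    apply in_map. apply Hm. exists w. simpl in Hw. repeat split; [| lia].
    intros y Hy. apply Hi. simpl; auto.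
Qed.

(** A finite submonoid of a group is a subgroup: two powers of [x] coincide, so [x * gpow x k] is
    the identity for some [k] and the inverse of [x] is itself a power of [x]. *)
Lemma finite_normal_monoid (M : G -> Prop) :
  no_nontrivial_finite_normal G ->
  M (gone G) -> (forall x y, M x -> M y -> M (x * y)) -> is_normal M ->
  is_finite_set M -> forall x, M x -> x = gone G.
Proof.
  intros HG H1 HM Hn Hf. apply HG; auto. split; [| split]; auto.
  assert (Hpow : forall x n, M x -> M (gpow x n)).
  { intros x n Hx. induction n as [| n IH]; simpl; auto. }
  intros x Hx. destruct Hf as [l Hl].
  destruct (@pigeonhole G (gpow x) l) as [i [k Hk]]; [auto |].
  rewrite gpowD in Hk. rewrite <- (gmul1r (gpow x i)) in Hk at 1.
  apply gmulI in Hk. simpl in Hk. rewrite (@ginv_unique x (gpow x k)); auto.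
Qed.

(* Conjugating the [m] occurrences of a letter to the front of a long word lets the
   hypothesis shorten it, so every word in [S] has the value of one of bounded length. *)
Lemma finite_shortening_trivial (S : G -> Prop) :
  no_nontrivial_finite_normal G -> is_normal S -> is_finite_set S ->
  (forall s, S s -> exists m w,
     Forall S w /\ (length w < m)%nat /\ gpow s m = gprod w) ->
  forall s, S s -> s = gone G.
Proof.
  intros HG HS [l Hl] Hshort.
  (* One exponent has to serve all of the finite set [S]. The maximum works, since both sides of a
     shortening relation can be padded with further copies of [s]. *)
  assert (HM : exists M, forall s, S s -> exists w,
     Forall S w /\ (length w < M)%nat /\ gpow s M = gprod w).
  { enough (forall l' : list G, exists M, forall s, In s l' -> S s -> exists w,
       Forall S w /\ (length w < M)%nat /\ gpow s M = gprod w) as He.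
    { destruct (He l) as [M HM]. exists M. auto. }
    assert (Hup : forall s m M w, S s -> Forall S w -> (length w < m)%nat ->
       gpow s m = gprod w -> (m <= M)%nat -> exists w',
       Forall S w' /\ (length w' < M)%nat /\ gpow s M = gprod w').
    { intros s m M w Hs Hw Hlen Heq HmM. exists (w ++ repeat s (M - m)). repeat split.
      - apply Forall_app. split; auto. apply Forall_forall. intros x Hx.
        apply repeat_spec in Hx. subst. auto.
      - rewrite length_app, repeat_length. lia.
      - rewrite gprod_app, gprod_repeat, <- Heq, <- gpowD. f_equal. lia. }
    induction l' as [| a l' [M HM]].
    - exists O. intros s [].
    - destruct (classic (S a)) as [Ha | Ha].
      + destruct (Hshort a Ha) as [m [w [H1 [H2 H3]]]].
        exists (Nat.max m M). intros s [<- | Hin] Hs.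
        * apply (Hup a m (Nat.max m M) w); auto. lia.
        * destruct (HM s Hin Hs) as [w' [H1' [H2' H3']]].
          apply (Hup s M (Nat.max m M) w'); auto. lia.
      + exists M. intros s [<- | Hin] Hs; [contradiction | auto]. }
  destruct HM as [M HM].
  (* A word longer than [length l * M] has a letter occurring at least [M] times; moving [M] copies
     to the front and shortening them reduces the length. *)
  assert (Hbound : forall n w, (length w <= n)%nat -> Forall S w -> exists w',
     Forall S w' /\ (length w' <= length l * M)%nat /\ gprod w = gprod w').
  { induction n as [| n IH]; intros w Hlen Hw.
    - exists w. repeat split; auto. lia.
    - destruct (le_lt_dec (length w) (length l * M)) as [Hle | Hlt].
      + exists w. auto.
      + assert (Hs : exists s, In s l /\
          (M <= count_occ (eq_dec_classic) w s)%nat).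
        { apply NNPP. intros Hno.
          enough (length w <= length l * M)%nat by lia.
          apply length_le_count.
          - intros x Hx. apply Hl. rewrite Forall_forall in Hw. auto.
          - intros s Hs. apply Nat.nlt_ge. intros Hc. apply Hno. exists s. split; auto. lia. }
        destruct Hs as [s [Hsl Hs]].
        destruct (classic (S s)) as [HSs | HSs].
        * destruct (word_extract _ _ _ _ HS Hw Hs) as [w1 [H1 [H2 H3]]].
          destruct (HM s HSs) as [w2 [H4 [H5 H6]]].
          destruct (IH (w2 ++ w1)) as [w' [H7 [H8 H9]]].
          { rewrite length_app. lia. }
          { apply Forall_app. auto. }
          exists w'. repeat split; auto.
          rewrite <- H9, gprod_app, <- H6, H3. reflexivity.
        (* The letter found might lie outside [S]. For positive [M] it occurs in [w], hence is in
           [S]; for [M = 0] the first letter of [w] would need a word of negative length. *)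
        * destruct M as [| M]; [exists w; repeat split; auto; exfalso |].
          { destruct w as [| a w]; simpl in Hlt; [lia |]. inversion Hw; subst.
            destruct (HM a) as [w2 [_ [H5 _]]]; auto. lia. }
          exfalso. apply HSs. rewrite Forall_forall in Hw. apply Hw.
          apply (count_occ_In (eq_dec_classic)). lia. }
  intros s Hs.
  apply (@finite_normal_monoid (fun x => exists w, Forall S w /\ x = gprod w) HG).
  - exists nil. auto.
  - intros x y [w1 [H1 ->]] [w2 [H2 ->]]. exists (w1 ++ w2). split.
    + apply Forall_app. auto.
    + symmetry. apply gprod_app.
  - intros g x [w [Hw ->]]. rewrite gprod_conj. eexists. split; [| reflexivity].
    apply Forall_map. eapply Forall_impl; [| apply Hw]. intros a Ha. apply HS. auto.
  - destruct (finite_words l (length l * M)) as [m Hm]. exists m.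
    intros x [w [Hw ->]]. destruct (Hbound (length w) w) as [w' [H1 [H2 H3]]]; auto.
    apply Hm. exists w'. repeat split; auto.
    intros y Hy. apply Hl. rewrite Forall_forall in H1. auto.
  - exists (s :: nil). split; auto. simpl. grp.
Qed.

(** * Finite conjugacy classes *)

Definition conj_class x : G -> Prop := fun y => exists g, y = g * x * g^-1.
Definition fc x : Prop := is_finite_set (conj_class x).

Lemma conj_class_normal x : is_normal (conj_class x).
Proof. intros g y [h ->]. exists (g * h). grp. Qed.

Lemma fc_one : fc (gone G).
Proof. exists (gone G :: nil). intros x [g ->]. left. grp. Qed.

Lemma fc_mul x y : fc x -> fc y -> fc (x * y).
Proof.
  intros [l Hl] [m Hm].
  exists (flat_map (fun a => map (fun b => a * b) m) l).
  intros z [g ->]. apply in_flat_map. exists (g * x * g^-1). split.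
  - apply Hl. exists g. auto.
  - apply in_map_iff. exists (g * y * g^-1). split; [grp |]. apply Hm. exists g. auto.
Qed.

Lemma fc_inv x : fc x -> fc (x^-1).
Proof.
  intros [l Hl]. exists (map (@ginv G) l). intros z [g ->].
  apply in_map_iff. exists (g * x * g^-1). split; [grp |]. apply Hl. exists g. auto.
Qed.

Lemma fc_pow x n : fc x -> fc (gpow x n).
Proof.
  intros Hx. induction n as [| n IH]; simpl; [apply fc_one | apply fc_mul; auto].
Qed.

(** Dicman's argument: all conjugates of [x] satisfy the same power relation, which shortens their
    [S n]-th powers to the empty word, so the finite class of [x] is a legitimate set of letters. *)
Lemma fc_torsion_free x n :
  no_nontrivial_finite_normal G -> fc x -> gpow x (S n) = gone G -> x = gone G.
Proof.
  intros HG Hx Hn.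
  apply (@finite_shortening_trivial (conj_class x)); auto.
  - apply conj_class_normal.
  - intros s [g ->]. exists (S n), nil. repeat split; auto.
    + simpl. lia.
    + rewrite gpow_conj, Hn. simpl. grp.
  - exists (gone G). grp.
Qed.

(* Schur's argument: if [c = a^-1 b^-1 a b] and [c^m] commutes with [b], then
   [c^(m+1) = (a^-1 b^-2 a b^2) (b^-1 c b)^(m-1)] is a product of [m] commutators. *)
Lemma fc_commute x y :
  no_nontrivial_finite_normal G -> fc x -> fc y -> x * y = y * x.
Proof.
  intros HG Hx Hy.
  pose (comm (a b : G) := a^-1 * b^-1 * a * b).
  pose (S0 (s : G) := exists g j, s = comm (g * x * g^-1) (g * gpow y j * g^-1)).
  enough (Hc : comm x y = gone G).
  { apply (@gmulI (y^-1)), (@gmulI (x^-1)). unfold comm in Hc.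
    rewrite <- !gmulA in Hc. rewrite Hc. grp. }
  apply (@finite_shortening_trivial S0); auto.
  - intros h s [g [j ->]]. exists (h * g), j. unfold comm. grp.
  (* A commutator is the inverse of one conjugate of [x] times another, so finiteness of the class
     of [x] suffices, whatever the exponent [j]. *)
  - destruct Hx as [l Hl].
    exists (flat_map (fun u => map (fun v => u^-1 * v) l) l).
    intros s [g [j ->]]. apply in_flat_map. exists (g * x * g^-1). split.
    + apply Hl. exists g. auto.
    + apply in_map_iff. exists (g * (gpow y j)^-1 * x * (g * (gpow y j)^-1)^-1).
      split; [unfold comm; grp |].
      apply Hl. exists (g * (gpow y j)^-1). grp.
  - intros s [g [j Hs]].
    assert (Hb : fc (g * gpow y j * g^-1)).
    { destruct (fc_pow y j Hy) as [l Hl]. exists l. intros z [h ->]. apply Hl.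
      exists (h * g). grp. }
    set (a := g * x * g^-1) in Hs. set (b := g * gpow y j * g^-1) in Hs, Hb.
    destruct Hb as [l Hl].
    (* The conjugates of [b] by powers of [s] lie in a finite set, so two agree and a positive power
       of [s] commutes with [b]. *)
    destruct (@pigeonhole G (fun i => gpow s i * b * (gpow s i)^-1) l) as [i [m Hm]].
    { intros i. apply Hl. exists (gpow s i). auto. }
    assert (Hcomm : gpow s (S m) * b = b * gpow s (S m)).
    { rewrite gpowD in Hm. apply (f_equal (fun z => (gpow s i)^-1 * z * gpow s i)) in Hm.
      apply (f_equal (fun z => z * gpow s (S m))) in Hm.
      revert Hm. generalize (gpow s i) (gpow s (S m)). intros u v. grp. }
    exists (S (S m)), (comm a (b * b) :: repeat (b^-1 * s * b^-1^-1) m).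
    assert (Hconj : S0 (b^-1 * s * b^-1^-1)).
    { rewrite Hs. exists (b^-1 * g), j. unfold comm, a, b. grp. }
    repeat split.
    + constructor.
      * exists g, (j + j)%nat. unfold a, b. rewrite gpowD. unfold comm. grp.
      * apply Forall_forall. intros z Hz. apply repeat_spec in Hz. subst z. auto.
    + simpl. rewrite repeat_length. lia.
    + simpl gprod. rewrite gprod_repeat, gpow_conj.
      change (gpow s (S (S m))) with (s * gpow s (S m)).
      apply (@gmulIr (b^-1)).
      transitivity (s * (b^-1 * (b * gpow s (S m))) * b^-1); [grp |].
      rewrite <- Hcomm. simpl gpow.
      replace (s * (b^-1 * (s * gpow s m * b)) * b^-1)
        with (s * b^-1 * s * gpow s m) by grp.
      rewrite Hs at 1 2. unfold comm. grp.
  - exists (gone G), 1%nat. rewrite gpow1. unfold comm. grp.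
Qed.

End GroupTheory.

(** * Finite-dimensional spaces of functions *)

Local Open Scope R_scope.

Section FiniteSums.
Variable T : Type.
Implicit Types (F B : list T) (a b u v w : T -> R).

Definition rsum a F : R := fold_right (fun x acc => a x + acc) 0 F.

Lemma rsum_ext a b F : (forall x, In x F -> a x = b x) -> rsum a F = rsum b F.
Proof.
  induction F as [| x F IH]; simpl; intros H; auto. rewrite H, IH; auto.
Qed.

Lemma rsum_lin (c d : R) a b F :
  rsum (fun x => c * a x + d * b x) F = c * rsum a F + d * rsum b F.
Proof. induction F as [| x F IH]; simpl; [| rewrite IH]; ring. Qed.

Lemma rsum_const (c : R) F : rsum (fun _ => c) F = INR (length F) * c.
Proof.
  induction F as [| x F IH]; simpl length; [simpl; ring |].
  rewrite S_INR. simpl. rewrite IH. ring.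
Qed.

Lemma rsum_le a b F : (forall x, In x F -> a x <= b x) -> rsum a F <= rsum b F.
Proof.
  induction F as [| x F IH]; simpl; intros H; [lra |].
  apply Rplus_le_compat; auto.
Qed.

Lemma rsum_nonneg a F : (forall x, In x F -> 0 <= a x) -> 0 <= rsum a F.
Proof.
  induction F as [| x F IH]; simpl; intros H; [lra |].
  apply Rplus_le_le_0_compat; auto.
Qed.

Lemma rsum_zero a F : (forall x, In x F -> a x = 0) -> rsum a F = 0.
Proof.
  intros H. rewrite (rsum_ext a (fun _ => 0) F H), rsum_const. ring.
Qed.

Lemma rsum_app a F B : rsum a (F ++ B) = rsum a F + rsum a B.
Proof. induction F as [| x F IH]; simpl; [| rewrite IH]; ring. Qed.

Lemma rsum_incl a F B : (forall x, 0 <= a x) -> NoDup F -> incl F B ->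
  rsum a F <= rsum a B.
Proof.
  intros Ha HF. revert B. induction HF as [| x F Hx HF IH]; intros B Hi; simpl.
  - apply rsum_nonneg. auto.
  - destruct (in_split x B) as [B1 [B2 ->]]; [apply Hi; simpl; auto |].
    assert (H : rsum a F <= rsum a (B1 ++ B2)).
    { apply IH. intros y Hy. assert (Hy' : In y (B1 ++ x :: B2)) by (apply Hi; simpl; auto).
      apply in_app_iff in Hy'. apply in_app_iff. destruct Hy' as [| [|]]; auto.
      subst y. contradiction. }
    rewrite rsum_app in H |- *. simpl. lra.
Qed.

Lemma rsum_elem a F x : (forall x, 0 <= a x) -> In x F -> a x <= rsum a F.
Proof.
  intros Ha Hx. replace (a x) with (rsum a (x :: nil)) by (simpl; ring).
  apply rsum_incl; auto.
  - constructor; auto. constructor.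
  - intros y [<- | []]. auto.
Qed.

Definition dot F u v : R := rsum (fun x => u x * v x) F.

Lemma dotC F u v : dot F u v = dot F v u.
Proof. apply rsum_ext. intros. ring. Qed.

Lemma dot_lin_l F (c d : R) u v w :
  dot F (fun x => c * u x + d * v x) w = c * dot F u w + d * dot F v w.
Proof.
  unfold dot. rewrite <- rsum_lin. apply rsum_ext. intros. ring.
Qed.

Lemma dot_ext F u v w : (forall x, In x F -> u x = v x) -> dot F u w = dot F v w.
Proof. intros H. apply rsum_ext. intros x Hx. rewrite H; auto. Qed.

Lemma dot_self_nonneg F u : 0 <= dot F u u.
Proof. apply rsum_nonneg. intros. nra. Qed.

Definition subspace (U : (T -> R) -> Prop) : Prop :=
  U (fun _ => 0) /\
  forall (c d : R) u v, U u -> U v -> U (fun x => c * u x + d * v x).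

(* [S x] is the squared norm of evaluation at [x] on [U]; its sum over [F] is the
   dimension of the restriction of [U] to [F], hence at most [length B]. The
   existence of orthogonal projections is carried along to make the induction work. *)
Lemma evaluation_bound F B (U : (T -> R) -> Prop) :
  subspace U -> incl B F ->
  (forall u, U u -> (forall y, In y B -> u y = 0) -> forall x, In x F -> u x = 0) ->
  (forall v, exists u, U u /\
     forall u', U u' -> dot F (fun x => 1 * v x + (-1) * u x) u' = 0) /\
  exists S : T -> R, (forall x, 0 <= S x) /\ rsum S F <= INR (length B) /\
    forall u x, U u -> In x F -> u x ^ 2 <= S x * dot F u u.
Proof.
  revert U. induction B as [| b B IH]; intros U [HU0 HU] Hi Hdet.
  - assert (HUF : forall u, U u -> forall x, In x F -> u x = 0).
    { intros u Hu. apply Hdet; auto. intros y []. }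
    split.
    + intros v. exists (fun _ => 0). split; auto. intros u' Hu'.
      apply rsum_zero. intros x Hx. rewrite (HUF u'); auto. ring.
    + exists (fun _ => 0). split; [intros; lra |]. split.
      * rewrite rsum_const. simpl. lra.
      * intros u x Hu Hx. rewrite (HUF u); auto. lra.
  (* The functions of [U] vanishing at [b] are determined on [F] by their values on the shorter list
     [B]. *)
  - destruct (IH (fun u => U u /\ u b = 0)) as [Hproj [S [HS0 [HSs HSu]]]].
    { split; [auto |]. intros c d u v [Hu Hub] [Hv Hvb]. split; auto.
      rewrite Hub, Hvb. ring. }
    { intros y Hy. apply Hi. simpl; auto. }
    { intros u [Hu Hub] HB. apply Hdet; auto. intros y [<- | Hy]; auto. }
    destruct (classic (exists u0, U u0 /\ u0 b <> 0)) as [[u0 [Hu0 Hu0b]] | Hno].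
    + destruct (Hproj u0) as [pu [[Hpu Hpub] Hpo]].
      (* [e] is the part of [u0] orthogonal to the functions of [U] vanishing at [b]. As [e b] is
         nonzero, each function of [U] is one of these plus a multiple of [e]. *)
      set (e := fun x => 1 * u0 x + (-1) * pu x) in Hpo.
      assert (He : U e) by (apply HU; auto).
      assert (Heb : e b <> 0) by (unfold e; rewrite Hpub; lra). clearbody e.
      assert (Hq : 0 < dot F e e).
      { apply Rlt_le_trans with (e b * e b); [nra |].
        apply (rsum_elem (fun x => e x * e x)); [intros; nra |]. apply Hi. simpl; auto. }
      assert (Hdec : forall u, U u -> exists u' t, U u' /\ u' b = 0 /\
                forall x, u x = 1 * u' x + t * e x).
      { intros u Hu. exists (fun x => 1 * u x + (- (u b / e b)) * e x), (u b / e b).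
        split; [auto |]. split; [field; auto | intros; ring]. }
      split.
      * intros v. destruct (Hproj v) as [pv [[Hpv Hpvb] Hvo]].
        exists (fun x => 1 * pv x + (dot F v e / dot F e e) * e x). split; auto.
        intros u Hu. destruct (Hdec u Hu) as [u' [t [Hu' [Hu'b Hut]]]].
        specialize (Hvo u' (conj Hu' Hu'b)). specialize (Hpo u' (conj Hu' Hu'b)) as Heu'.
        specialize (Hpo pv (conj Hpv Hpvb)) as Hepv.
        set (c := dot F v e / dot F e e). rewrite dotC, (dot_ext F u (fun x => 1 * u' x + t * e x)) by auto.
        rewrite dot_lin_l, (dotC F u'), (dotC F e), !dot_lin_l.
        rewrite dot_lin_l in Hvo. rewrite (dotC F pv e), Hepv, Heu'.
        replace (dot F v u') with (dot F pv u') by lra. unfold c. field. lra.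
      (* The new direction [e] contributes its normalized square, whose sum over [F] is exactly
         1. *)
      * exists (fun x => 1 * S x + (/ dot F e e) * (e x * e x)). split; [| split].
        { intros x. specialize (HS0 x). apply Rplus_le_le_0_compat; [lra |].
          apply Rmult_le_pos; [apply Rlt_le, Rinv_0_lt_compat; auto | nra]. }
        { rewrite rsum_lin. fold (dot F e e). rewrite Rinv_l by lra.
          change (length (b :: B)) with (Datatypes.S (length B)). rewrite S_INR. lra. }
        { intros u x Hu Hx. destruct (Hdec u Hu) as [u' [t [Hu' [Hu'b Hut]]]].
          specialize (HSu u' x (conj Hu' Hu'b) Hx).
          specialize (Hpo u' (conj Hu' Hu'b)) as Heu'.
          assert (Hn : dot F u u = dot F u' u' + t ^ 2 * dot F e e).
          { rewrite (dot_ext F u (fun x => 1 * u' x + t * e x)) by auto.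
            rewrite dot_lin_l, (dotC F u' u), (dotC F e u).
            rewrite !(dot_ext F u (fun x => 1 * u' x + t * e x)) by auto.
            rewrite !dot_lin_l, (dotC F u' e), Heu'. ring. }
          rewrite Hn, Hut. set (N := dot F u' u') in *. set (q := dot F e e) in *.
          assert (HN : 0 <= N) by apply dot_self_nonneg.
          specialize (HS0 x).
          set (y := u' x) in *. set (z := e x). set (s := S x) in *.
          assert (Hz : exists r, z = r * q) by (exists (z / q); field; lra).
          destruct Hz as [r Hr]. rewrite Hr.
          replace ((1 * s + / q * (r * q * (r * q))) * (N + t ^ 2 * q))
            with (s * N + t ^ 2 * (r * q) ^ 2 + q * (s * t ^ 2 + r ^ 2 * N))
            by (field; lra).
          (* The cross term of Cauchy-Schwarz: the square of [y * t * r] is at most the product of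
             the two right-hand terms, by the bound for [u'], and the arithmetic-geometric mean
             inequality applies. *)
          assert (HA : 2 * (y * t * r) <= s * t ^ 2 + r ^ 2 * N).
          { assert (H1 : 0 <= s * t ^ 2) by nra. assert (H2 : 0 <= r ^ 2 * N) by nra.
            assert (H3 : (y * t * r) ^ 2 <= (s * t ^ 2) * (r ^ 2 * N)).
            { replace ((y * t * r) ^ 2) with ((t * r) ^ 2 * y ^ 2) by ring.
              replace ((s * t ^ 2) * (r ^ 2 * N)) with ((t * r) ^ 2 * (s * N)) by ring.
              apply Rmult_le_compat_l; auto. nra. }
            revert H1 H2 H3. generalize (s * t ^ 2) (r ^ 2 * N) (y * t * r).
            intros A C w HA HC HAC. apply Rnot_lt_le. intros Hlt.
            pose proof (pow2_ge_0 (A - C)). assert ((A + C) * (A + C) < 2 * w * (2 * w)) by nra. nra. }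
          apply (Rmult_le_compat_l q) in HA; [| lra].
          replace ((1 * y + t * (r * q)) ^ 2)
            with (y ^ 2 + t ^ 2 * (r * q) ^ 2 + q * (2 * (y * t * r))) by ring.
          lra. }
    + assert (Hall : forall u, U u -> u b = 0).
      { intros u Hu. apply NNPP. intros Hne. apply Hno. exists u. auto. }
      split.
      * intros v. destruct (Hproj v) as [u [[Hu _] Ho]]. exists u. split; auto.
      * exists S. split; [auto |]. split; [| auto].
        change (length (b :: B)) with (Datatypes.S (length B)). rewrite S_INR. lra.
Qed.

End FiniteSums.

Arguments rsum {T}.
Arguments dot {T}.

Lemma rsum_map (T T' : Type) (a : T' -> R) (f : T -> T') (F : list T) :
  rsum a (map f F) = rsum (fun x => a (f x)) F.
Proof. induction F as [| x F IH]; simpl; [| rewrite IH]; auto. Qed.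

(** * Polynomial against exponential growth *)

Lemma poly_le_exp (r : nat) (q : R) : 1 < q ->
  exists A, 0 < A /\ forall n, INR (S n) ^ r <= A * q ^ n.
Proof.
  revert q. induction r as [| r IH]; intros q Hq.
  - exists 1. split; [lra |]. intros n. simpl. rewrite Rmult_1_l. apply pow_R1_Rle. lra.
  (* Half of the exponential, [sqrt q ^ n], absorbs [r] factors by induction; the other half absorbs
     the last factor by Bernoulli's inequality. *)
  - assert (Hs : 1 < sqrt q) by (rewrite <- sqrt_1; apply sqrt_lt_1; lra).
    destruct (IH (sqrt q) Hs) as [A [HA HAn]].
    set (d := sqrt q - 1).
    assert (Hd : 0 < d) by (unfold d; lra).
    exists (A * (1 + / d)). split.
    { apply Rmult_lt_0_compat; auto. assert (0 < / d) by (apply Rinv_0_lt_compat; auto). lra. }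
    intros n. specialize (HAn n).
    assert (Hlin : INR (S n) <= (1 + / d) * sqrt q ^ n).
    { pose proof (poly n d Hd) as Hb. replace (1 + d) with (sqrt q) in Hb by (unfold d; ring).
      assert (Hid : 0 < / d) by (apply Rinv_0_lt_compat; auto).
      assert (H1 : (1 + / d) * (1 + INR n * d) <= (1 + / d) * sqrt q ^ n)
        by (apply Rmult_le_compat_l; lra).
      replace ((1 + / d) * (1 + INR n * d)) with (1 + / d + INR n * d + INR n) in H1
        by (field; lra).
      rewrite S_INR. pose proof (pos_INR n). nra. }
    replace (q ^ n) with (sqrt q ^ n * sqrt q ^ n)
      by (rewrite <- Rpow_mult_distr, sqrt_sqrt; auto; lra).
    rewrite <- tech_pow_Rmult. replace (A * (1 + / d) * (sqrt q ^ n * sqrt q ^ n))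
      with (((1 + / d) * sqrt q ^ n) * (A * sqrt q ^ n)) by ring.
    apply Rmult_le_compat; auto; [apply pos_INR | apply pow_le, pos_INR].
Qed.

Lemma exp_not_le_poly (r : nat) (q : R) : 1 < q ->
  exists n, INR (S n) ^ r < q ^ n.
Proof.
  intros Hq.
  assert (Hs : 1 < sqrt q) by (rewrite <- sqrt_1; apply sqrt_lt_1; lra).
  destruct (poly_le_exp r _ Hs) as [A [HA HAn]].
  (* The spare factor [sqrt q ^ n] eventually beats the constant [A]. *)
  destruct (Pow_x_infinity (sqrt q)) with (b := A + 1) as [n Hn].
  { rewrite Rabs_pos_eq; lra. }
  exists n. specialize (Hn n (Nat.le_refl n)).
  rewrite Rabs_pos_eq in Hn by (apply pow_le; lra).
  replace (q ^ n) with (sqrt q ^ n * sqrt q ^ n)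
    by (rewrite <- Rpow_mult_distr, sqrt_sqrt; auto; lra).
  specialize (HAn n). nra.
Qed.

(** * Torsion-free abelian groups *)

Section TorsionFreeAbelian.
Variable G : Group.
Local Open Scope grp_scope.
Variable D : G -> Prop.
Hypothesis D_subgroup : is_subgroup D.
Hypothesis D_comm : forall x y, D x -> D y -> x * y = y * x.
Hypothesis D_tf : forall x n, D x -> gpow G x (S n) = gone G -> x = gone G.
Implicit Types (x y s t d : G) (P Q : G -> Prop) (S L F : list G).

Let D1 : D (gone G) := proj1 D_subgroup.
Let DM : forall x y, D x -> D y -> D (x * y) := proj1 (proj2 D_subgroup).
Let DV : forall x, D x -> D (x^-1) := proj2 (proj2 D_subgroup).

(** * Positive cones of partial orders *)

Lemma D_pow x n : D x -> D (gpow G x n).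
Proof. intros Hx. induction n as [| n IH]; simpl; auto. Qed.

(** The positive elements of a translation-invariant strict partial order on [D]: [x] lies below [y]
    when [P (x^-1 * y)]. *)
Definition cone P : Prop :=
  (forall x, P x -> D x) /\ ~ P (gone G) /\ (forall x y, P x -> P y -> P (x * y)).

Lemma cone_pow P x n : cone P -> P x -> P (gpow G x (Datatypes.S n)).
Proof.
  intros [_ [_ HM]] Hx. induction n as [| n IH]; [rewrite gpow1; auto |].
  change (P (x * gpow G x (Datatypes.S n))). auto.
Qed.

(** The subsemigroup generated by [P] and [s]. The condition [0 < n] excludes the empty product, so
    the identity belongs to it only through a genuine relation. *)
Definition adjoin P s : G -> Prop := fun x =>
  exists n t, (P t \/ t = gone G /\ (0 < n)%nat) /\ x = gpow G s n * t.

Lemma adjoin_cone P s : cone P -> D s -> ~ adjoin P s (gone G) -> cone (adjoin P s).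
Proof.
  intros [HD [H1 HM]] Hs Hn. split; [| split]; auto.
  - intros x [n [t [[Ht | [-> _]] ->]]]; apply DM; auto; apply D_pow; auto.
  - intros x y [n [t [Ht ->]]] [m [t' [Ht' ->]]].
    assert (Dt : D t) by (destruct Ht as [Ht | [-> _]]; auto).
    exists (n + m)%nat, (t * t'). split.
    + destruct Ht as [Ht | [-> Ht]], Ht' as [Ht' | [-> Ht']];
        rewrite ?gmul1, ?gmul1r; auto. right. split; auto. lia.
    + rewrite gpowD. rewrite <- !gmulA. f_equal. rewrite !gmulA. f_equal.
      apply D_comm; auto. apply D_pow; auto.
Qed.

Lemma gpow_inv x n : gpow G (x^-1) n = (gpow G x n)^-1.
Proof.
  symmetry. apply ginv_unique. rewrite <- gpow_mul.
  - rewrite gmulVr. apply gpow_of_one.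
  - rewrite gmulVr, gmulV. reflexivity.
Qed.

(** If both signs failed, some [t] and [t'] in [P] would be a negative and a positive power of [s].
    Suitable powers of them multiply to the identity, which is not in [P]. Torsion-freeness rules
    out the degenerate relations. *)
Lemma adjoin_avoids P s : cone P -> D s -> s <> gone G ->
  ~ adjoin P s (gone G) \/ ~ adjoin P (s^-1) (gone G).
Proof.
  intros HP Hs Hs1. apply NNPP. intros Hno.
  apply not_or_and in Hno. destruct Hno as [H H'].
  apply NNPP in H, H'. destruct H as [m [t [Ht Hm]]], H' as [n [t' [Ht' Hn]]].
  assert (HP' := HP). destruct HP' as [_ [H1 HM]].
  assert (Htm : t = (gpow G s m)^-1) by (symmetry; apply ginv_unique; auto).
  assert (Htn : t' = gpow G s n).
  { rewrite gpow_inv in Hn. symmetry in Hn. apply ginv_unique in Hn.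
    rewrite <- Hn. apply ginvK. }
  assert (Hsn : forall k, gpow G s (Datatypes.S k) <> gone G).
  { intros k Hk. apply Hs1. apply (D_tf s k); auto. }
  destruct m as [| m].
  { simpl in Htm. rewrite ginv1 in Htm. subst t.
    destruct Ht as [Ht | [_ Ht]]; [auto | lia]. }
  destruct n as [| n].
  { simpl in Htn. subst t'. destruct Ht' as [Ht' | [_ Ht']]; [auto | lia]. }
  assert (Pt : P t).
  { destruct Ht as [Ht | [Ht _]]; auto. exfalso. apply (Hsn m).
    rewrite <- (ginvK _ (gpow _ _ _)), <- Htm, Ht. apply ginv1. }
  assert (Pt' : P t').
  { destruct Ht' as [Ht' | [Ht' _]]; auto. exfalso. apply (Hsn n). congruence. }
  apply H1.
  replace (gone G) with (gpow G t (Datatypes.S n) * gpow G t' (Datatypes.S m)).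
  - apply HM; apply cone_pow; auto.
  - rewrite Htm, Htn, <- gpow_inv, <- !gpowM, (Nat.mul_comm (Datatypes.S m)), gpow_inv.
    apply gmulV.
Qed.

(** Starting from the empty cone, a sign is chosen for one element of the list at a time; earlier
    choices persist because [adjoin] only enlarges the cone. *)
Lemma cone_exists S : (forall s, In s S -> D s /\ s <> gone G) ->
  exists P, cone P /\ forall s, In s S -> P s \/ P (s^-1).
Proof.
  induction S as [| s S IH]; intros HS.
  - exists (fun _ => False). split; [| intros s []].
    split; [| split]; tauto.
  - destruct IH as [P [HP HPS]]; [intros; apply HS; simpl; auto |].
    destruct (HS s (or_introl eq_refl)) as [Hs Hs1].
    assert (Hstep : forall r, D r -> ~ adjoin P r (gone G) -> (r = s \/ r = s^-1) ->
      exists P', cone P' /\ forall x, In x (s :: S) -> P' x \/ P' (x^-1)).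
    { intros r Hr Hr1 Hrs. exists (adjoin P r). split; [apply adjoin_cone; auto |].
      assert (Hin : forall x, P x -> adjoin P r x).
      { intros x Hx. exists O, x. split; auto. symmetry. apply gmul1. }
      assert (Hrr : adjoin P r r).
      { exists 1%nat, (gone G). split; [right; auto |]. rewrite gpow1. symmetry. apply gmul1r. }
      intros x [<- | Hx].
      - destruct Hrs as [<- | <-]; auto.
      - destruct (HPS x Hx); auto. }
    destruct (adjoin_avoids P s HP Hs Hs1) as [H | H].
    + apply (Hstep s); auto.
    + apply (Hstep (s^-1)); auto.
Qed.

Lemma cone_top L : L <> nil -> (forall l, In l L -> D l) ->
  exists P m, cone P /\ In m L /\ forall l, In l L -> l <> m -> P (l^-1 * m).
Proof.
  intros HL HLD.
  (* Giving a sign to every nontrivial quotient [l^-1 * l'] makes [L] a chain, which has a largest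
     element. *)
  destruct (cone_exists (filter (fun x => if eq_dec_classic x (gone G) then false else true)
     (flat_map (fun l => map (fun l' => l^-1 * l') L) L))) as [P [HP HPS]].
  { intros s Hs. apply filter_In in Hs. destruct Hs as [Hs Hs1].
    destruct (eq_dec_classic s (gone G)); [discriminate |]. split; auto.
    apply in_flat_map in Hs. destruct Hs as [l [Hl Hs]].
    apply in_map_iff in Hs. destruct Hs as [l' [<- Hl']]. auto. }
  assert (Htot : forall l l', In l L -> In l' L -> l <> l' ->
     P (l^-1 * l') \/ P (l'^-1 * l)).
  { intros l l' Hl Hl' Hne.
    destruct (HPS (l^-1 * l')) as [H | H]; auto.
    - apply filter_In. split.
      + apply in_flat_map. exists l. split; auto. apply in_map_iff. exists l'. auto.
      + destruct (eq_dec_classic (l^-1 * l') (gone G)) as [e | e]; auto.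
        exfalso. apply Hne. apply ginv_unique in e. rewrite <- e. symmetry. apply ginvK.
    - rewrite ginvM, ginvK in H. auto. }
  enough (H : forall L', L' <> nil -> incl L' L ->
    exists m, In m L' /\ forall l, In l L' -> l <> m -> P (l^-1 * m)).
  { destruct (H L HL (incl_refl L)) as [m [Hm Hmax]]. exists P, m. auto. }
  induction L' as [| a L' IH]; intros Hne Hi; [congruence |].
  destruct L' as [| b L'].
  { exists a. split; simpl; auto. intros l [<- | []] H. congruence. }
  destruct IH as [m [Hm Hmax]]; [discriminate | intros x Hx; apply Hi; simpl; auto |].
  destruct (eq_dec_classic a m) as [<- | Ham].
  { exists a. split; [left; auto |]. intros l [<- | Hl] Hla; [congruence | auto]. }
  assert (Ha : In a L) by (apply Hi; left; auto).
  assert (HmL : In m L) by (apply Hi; right; auto).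
  destruct (Htot a m Ha HmL Ham) as [H | H].
  - exists m. split; [right; auto |]. intros l [<- | Hl] Hlm; auto.
  - exists a. split; [left; auto |]. intros l [<- | Hl] Hla; [congruence |].
    destruct (eq_dec_classic l m) as [-> | Hlm]; auto.
    replace (l^-1 * a) with ((l^-1 * m) * (m^-1 * a)).
    + apply HP; auto.
    + rewrite <- gmulA, gmulKV. auto.
Qed.

Lemma cone_minimal P Q F : cone P -> (exists x, In x F /\ Q x) ->
  exists x, In x F /\ Q x /\ forall y, In y F -> Q y -> ~ P (y^-1 * x).
Proof.
  intros [_ [H1 HM]]. induction F as [| a F IH]; intros [x [Hx HQ]]; [destruct Hx |].
  destruct (classic (exists x, In x F /\ Q x)) as [He | He].
  - destruct (IH He) as [m [Hm [HQm Hmin]]].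
    destruct (classic (Q a /\ P (a^-1 * m))) as [[Ha Ham] | Hn].
    + exists a. split; [left; auto |]. split; auto. intros y [<- | Hy] HQy HP.
      * rewrite gmulV in HP. auto.
      * apply (Hmin y Hy HQy). replace (y^-1 * m) with ((y^-1 * a) * (a^-1 * m)); auto.
        rewrite <- gmulA, gmulKV. auto.
    + exists m. split; [right; auto |]. split; auto. intros y [<- | Hy] HQy HP; auto.
      apply (Hmin y); auto.
  - exists a. destruct Hx as [<- | Hx]; [| exfalso; apply He; exists x; auto].
    split; [left; auto |]. split; auto. intros y [<- | Hy] HQy HP.
    + rewrite gmulV in HP. auto.
    + apply He. exists y. auto.
Qed.

(* The equation at [d] expresses [w (d * m)] through values of [w] at strictly smaller
   points, so [w] on [F] is determined by its values outside [F' * m]. *)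
Lemma determined P m L F F' (w : G -> R) :
  cone P -> In m L -> NoDup L -> (forall l, In l L -> l <> m -> P (l^-1 * m)) ->
  (forall d l, In d F' -> In l L -> In (d * l) F) ->
  (forall d, In d F' -> rsum (fun l => w (d * l)) L = 0%R) ->
  (forall x, In x F -> ~ In x (map (fun d => d * m) F') -> w x = 0%R) ->
  forall x, In x F -> w x = 0%R.
Proof.
  intros HP Hm HL Hmax HF' Heq Hout. apply NNPP. intros Hno.
  assert (He : exists x, In x F /\ w x <> 0%R).
  { apply NNPP. intros Hn. apply Hno. intros x Hx. apply NNPP. intros Hw.
    apply Hn. exists x. auto. }
  destruct (cone_minimal P (fun x => w x <> 0%R) F HP He) as [x [Hx [Hwx Hmin]]].
  destruct (classic (In x (map (fun d => d * m) F'))) as [Hin | Hin]; [| auto].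
  apply in_map_iff in Hin. destruct Hin as [d [<- Hd]]. apply Hwx.
  rewrite <- (Heq d Hd). destruct (in_split m L Hm) as [L1 [L2 HL12]].
  assert (Hz : forall l, In l (L1 ++ L2) -> w (d * l) = 0%R).
  { intros l Hl. assert (Hl' : In l L).
    { rewrite HL12. apply in_app_iff in Hl. apply in_app_iff. simpl. tauto. }
    assert (Hlm : l <> m).
    { rewrite HL12 in HL. apply NoDup_remove_2 in HL. congruence. }
    (* [d * l] lies strictly below [d * m], because their quotient is [l^-1 * m]; a nonzero value
       there would contradict minimality. *)
    apply NNPP. intros Hw. apply (Hmin (d * l)); auto.
    rewrite ginvM, <- gmulA, gmulVK. auto. }
  rewrite HL12, rsum_app. simpl.
  rewrite (rsum_zero _ _ L1), (rsum_zero _ _ L2).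
  - ring.
  - intros l Hl. apply Hz. apply in_app_iff. auto.
  - intros l Hl. apply Hz. apply in_app_iff. auto.
Qed.

(** * Boxes of bounded exponents *)

Fixpoint box L (n : nat) : list G :=
  match L with
  | nil => gone G :: nil
  | l :: L => flat_map (fun i => map (fun y => gpow G l i * y) (box L n)) (seq 0 (S n))
  end.

Lemma in_box_cons l L n x : In x (box (l :: L) n) <->
  exists i y, (i <= n)%nat /\ In y (box L n) /\ x = gpow G l i * y.
Proof.
  change (In x (flat_map (fun i => map (fun y => gpow G l i * y) (box L n)) (seq 0 (S n)))
    <-> exists i y, (i <= n)%nat /\ In y (box L n) /\ x = gpow G l i * y).
  rewrite in_flat_map. split.
  - intros [i [Hi Hx]]. apply in_seq in Hi. apply in_map_iff in Hx.
    destruct Hx as [y [<- Hy]]. exists i, y. repeat split; auto. lia.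
  - intros [i [y [Hi [Hy ->]]]]. exists i. split; [apply in_seq; lia |].
    apply in_map_iff. eauto.
Qed.

Lemma length_box L n : length (box L n) = (S n ^ length L)%nat.
Proof.
  induction L as [| l L IH]; auto.
  change (length (flat_map (fun i => map (fun y => gpow G l i * y) (box L n)) (seq 0 (S n)))
    = (S n * S n ^ length L)%nat).
  rewrite <- IH. rewrite <- (length_seq (S n) 0) at 2.
  induction (seq 0 (S n)) as [| i s IHs]; auto.
  simpl. rewrite length_app, length_map, IHs. auto.
Qed.

Lemma box_D L n x : (forall l, In l L -> D l) -> In x (box L n) -> D x.
Proof.
  revert x. induction L as [| l L IH]; intros x HL Hx.
  - destruct Hx as [<- | []]. auto.
  - apply in_box_cons in Hx. destruct Hx as [i [y [_ [Hy ->]]]].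
    apply DM; [apply D_pow; apply HL; simpl; auto |].
    apply IH; auto. intros; apply HL; simpl; auto.
Qed.

Lemma box_mono L n x : In x (box L n) -> In x (box L (S n)).
Proof.
  revert x. induction L as [| l L IH]; intros x Hx; auto.
  apply in_box_cons in Hx. destruct Hx as [i [y [Hi [Hy ->]]]].
  apply in_box_cons. exists i, y. repeat split; auto.
Qed.

Lemma box_one L n : In (gone G) (box L n).
Proof.
  induction L as [| l L IH]; [left; auto |].
  apply in_box_cons. exists O, (gone G). repeat split; auto; [lia |].
  symmetry. apply gmul1.
Qed.

Lemma box_step L n x l : (forall l, In l L -> D l) ->
  In x (box L n) -> In l L -> In (x * l) (box L (S n)).
Proof.
  revert x. induction L as [| a L IH]; intros x HL Hx Hl; [destruct Hl |].
  apply in_box_cons in Hx. destruct Hx as [i [y [Hi [Hy ->]]]].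
  apply in_box_cons. destruct Hl as [<- | Hl].
  - exists (S i), y. repeat split; [lia | apply box_mono; auto |].
    simpl. rewrite <- gmulA, (D_comm y a), gmulA.
    + f_equal. apply gpow_commute. auto.
    + apply (box_D L n); auto. intros; apply HL; simpl; auto.
    + apply HL; simpl; auto.
  - exists i, (y * l). repeat split; [lia | | apply eq_sym, gmulA].
    apply IH; auto. intros; apply HL; simpl; auto.
Qed.

(* Otherwise [evaluation_bound], applied to the translates of [q] on boxes, makes the
   number of points of the boxes grow exponentially, although it is polynomial. *)
Lemma abelian_pompeiu L (q : G -> R) (M : R) :
  L <> nil -> NoDup L -> (forall l, In l L -> D l) ->
  (forall F, NoDup F -> rsum (fun x => q x ^ 2)%R F <= M)%R ->
  (forall d, D d -> rsum (fun l => q (d * l)) L = 0%R) ->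
  q (gone G) = 0%R.
Proof.
  intros HL0 HL HLD HM Heq. apply NNPP. intros Hq.
  destruct (cone_top L HL0 HLD) as [P [m [HP [Hm Hmax]]]].
  (* [box] lists exponent vectors and may repeat elements; its length still bounds the number of
     distinct ones. *)
  pose (F n := nodup eq_dec_classic (box L n)).
  assert (HFD : forall n x, In x (F n) -> D x).
  { intros n x Hx. apply nodup_In in Hx. apply (box_D L n); auto. }
  assert (HFnd : forall n, NoDup (F n)) by (intros; apply NoDup_nodup).
  set (c := (q (gone G) ^ 2)%R).
  assert (Hc : (0 < c)%R) by (unfold c; nra).
  (* Both sides estimate [M] times the sum of squared evaluation norms over [F (S n)]: from below by
     [c] at every point, from above by [M] times the size of [B]. *)
  assert (Hgrow : forall n, (c * INR (length (F (S n)))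
            <= M * (INR (length (F (S n))) - INR (length (F n))))%R).
  { intros n.
    pose (inner x := if in_dec eq_dec_classic x (map (fun d => d * m) (F n))
                     then false else true).
    pose (B := filter inner (F (S n))).
    assert (HB : forall x, In x B <->
              In x (F (S n)) /\ ~ In x (map (fun d => d * m) (F n))).
    { intros x. unfold B. rewrite filter_In. unfold inner.
      destruct (in_dec _ _ _); intuition discriminate. }
    assert (Hstep : forall d l, In d (F n) -> In l L -> In (d * l) (F (S n))).
    { intros d l Hd Hl. apply nodup_In. apply nodup_In in Hd. apply box_step; auto. }
    assert (HBlen : (length B + length (F n) <= length (F (S n)))%nat).
    { rewrite <- (length_map (fun d => d * m) (F n)), <- length_app.
      apply NoDup_incl_length.
      - apply NoDup_app.
        + apply NoDup_filter. auto.
        + apply Injective_map_NoDup; auto. intros x y Hxy. apply (gmulIr G _ _ _ Hxy).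
        + intros x Hx. apply HB in Hx. tauto.
      - intros x Hx. apply in_app_iff in Hx. destruct Hx as [Hx | Hx].
        + apply HB in Hx. tauto.
        + apply in_map_iff in Hx. destruct Hx as [d [<- Hd]]. auto. }
    destruct (evaluation_bound G (F (S n)) B
      (fun w => forall d, In d (F n) -> rsum (fun l => w (d * l)) L = 0%R))
      as [_ [S [HS0 [HSs HSu]]]].
    { split.
      - intros d _. apply rsum_zero. auto.
      - intros a b u v Hu Hv d Hd. rewrite (rsum_lin G a b (fun l => u (d * l))), Hu, Hv; auto.
        ring. }
    { intros x Hx. apply HB in Hx. tauto. }
    { intros w Hw HwB. apply (determined P m L (F (Datatypes.S n)) (F n)); auto.
      intros x Hx Hxn. apply HwB. apply HB. auto. }
    (* The translate [q (x^-1 * y)] solves the same equations, takes the value [q (gone G)] at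
       [y = x], and has squared norm at most [M]. *)
    assert (Hpt : forall x, In x (F (Datatypes.S n)) -> (c <= S x * M)%R).
    { intros x Hx. specialize (HSu (fun y => q (x^-1 * y)) x).
      simpl in HSu. rewrite gmulV in HSu. unfold c.
      eapply Rle_trans; [apply HSu; auto |].
      - intros d Hd. rewrite <- (Heq (x^-1 * d)); [| apply DM; eauto].
        apply rsum_ext. intros l _. rewrite gmulA. auto.
      - apply Rmult_le_compat_l; auto.
        eapply Rle_trans; [| apply (HM (map (fun y => x^-1 * y) (F (Datatypes.S n))))].
        + rewrite rsum_map. right. apply rsum_ext. intros. ring.
        + apply Injective_map_NoDup; auto. intros y z Hyz. apply (gmulI G _ _ _ Hyz). }
    assert (HM0 : (0 <= M)%R) by (apply (HM nil); constructor).
    pose proof (rsum_le G (fun _ => c) (fun x => M * S x + 0 * 0)%R (F (Datatypes.S n)))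
      as Hsum.
    rewrite rsum_const, (rsum_lin G M 0 S (fun _ => 0%R)) in Hsum.
    apply le_INR in HBlen. rewrite plus_INR in HBlen.
    eapply Rle_trans; [| apply Rmult_le_compat_l; [auto |]; apply Rle_trans with (INR (length B))].
    - rewrite Rmult_comm. eapply Rle_trans; [apply Hsum |].
      + intros x Hx. specialize (Hpt x Hx). lra.
      + rewrite Rmult_0_l, Rplus_0_r. apply Rmult_le_compat_l; [auto | apply HSs].
    - apply Rle_refl.
    - lra. }
  assert (HcM : (c <= M)%R).
  { specialize (HM (gone G :: nil)). simpl in HM. unfold c. simpl.
    rewrite Rplus_0_r in HM. apply HM. constructor; [intros [] | constructor]. }
  assert (HF1 : forall n, (1 <= INR (length (F n)))%R).
  { intros n. apply (le_INR 1). assert (Hin : In (gone G) (F n)).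
    { apply nodup_In, box_one. }
    destruct (F n); [destruct Hin | simpl; lia]. }
  (* Rearranged, [Hgrow] reads: [M - c] times the next length is at least [M] times the current one.
     As the lengths are positive, [M - c] is too, and each step multiplies the length by at least
     [M / (M - c)]. *)
  assert (HMc : (0 < M - c)%R).
  { specialize (Hgrow O). pose proof (HF1 O). pose proof (HF1 1%nat). nra. }
  assert (Hk : (1 < M / (M - c))%R).
  { apply Rmult_lt_reg_r with (M - c)%R; auto. field_simplify; lra. }
  assert (Hexp : forall n, ((M / (M - c)) ^ n <= INR (length (F n)))%R).
  { induction n as [| n IH]; [apply HF1 |].
    apply Rmult_le_reg_l with (M - c)%R; auto. simpl pow.
    replace ((M - c) * (M / (M - c) * (M / (M - c)) ^ n))%R
      with (M * (M / (M - c)) ^ n)%R by (field; lra).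
    apply Rle_trans with (M * INR (length (F n)))%R.
    - apply Rmult_le_compat_l; lra.
    - specialize (Hgrow n). lra. }
  destruct (exp_not_le_poly (length L) _ Hk) as [n Hn].
  apply (Rlt_irrefl (INR (S n) ^ length L)%R).
  eapply Rlt_le_trans; [apply Hn |]. eapply Rle_trans; [apply Hexp |].
  rewrite <- pow_INR, <- length_box. apply le_INR.
  apply NoDup_incl_length; auto. intros x Hx. apply nodup_In in Hx. auto.
Qed.

End TorsionFreeAbelian.

(** * The closest point to the point mass *)

Lemma rsum_filter (T : Type) (a : T -> R) (f : T -> bool) (F : list T) :
  (forall x, f x = false -> a x = 0) -> rsum a (filter f F) = rsum a F.
Proof.
  intros Ha. induction F as [| x F IH]; simpl; auto.
  destruct (f x) eqn:Hx; simpl; rewrite IH; auto. rewrite (Ha x Hx). ring.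
Qed.

Lemma is_lim_seq_rsum (T : Type) (a : nat -> T -> R) (b : T -> R) (F : list T) :
  (forall x, is_lim_seq (fun n => a n x) (b x)) ->
  is_lim_seq (fun n => rsum (a n) F) (rsum b F).
Proof.
  intros H. induction F as [| x F IH]; simpl; [apply is_lim_seq_const |].
  apply is_lim_seq_plus'; auto.
Qed.

Lemma is_lim_seq_add_inv (d : R) : is_lim_seq (fun n => d + / INR (S n)) d.
Proof.
  replace (Finite d) with (Finite (d + 0)) by (f_equal; ring).
  apply is_lim_seq_plus'; [apply is_lim_seq_const |].
  apply (is_lim_seq_incr_1 (fun n => / INR n)).
  apply (is_lim_seq_inv INR p_infty); [apply is_lim_seq_INR | discriminate].
Qed.

Lemma infimum (E : R -> Prop) (m : R) :
  (exists r, E r) -> (forall r, E r -> m <= r) ->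
  exists d, (forall r, E r -> d <= r) /\
    forall eps, 0 < eps -> exists r, E r /\ r < d + eps.
Proof.
  intros [r0 Hr0] Hm.
  destruct (completeness (fun x => E (- x))) as [s [Hs Hs']].
  - exists (- m). intros x Hx. apply Hm in Hx. lra.
  - exists (- r0). rewrite Ropp_involutive. auto.
  - exists (- s). split.
    + intros r Hr. rewrite <- (Ropp_involutive r) in Hr. specialize (Hs (- r) Hr). lra.
    + intros eps Heps. apply NNPP. intros Hno.
      assert (H : s <= s - eps); [| lra]. apply Hs'. intros x Hx.
      apply Rnot_lt_le. intros Hlt. apply Hno. exists (- x). split; auto. lra.
Qed.

Section SquareSummable.
Variable G : Group.
Local Open Scope grp_scope.
Implicit Types (x y g h : G) (u v w : G -> R) (F : list G).

(** A bound on all finite partial sums stands for the squared norm, so no infinite sum has to be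
    evaluated. *)
Definition normsq_le v (r : R) : Prop :=
  forall F, NoDup F -> (rsum (fun x => v x ^ 2) F <= r)%R.

Lemma normsq_le_lin u v (r s a b : R) : normsq_le u r -> normsq_le v s ->
  normsq_le (fun x => a * u x + b * v x)%R (2 * a ^ 2 * r + 2 * b ^ 2 * s)%R.
Proof.
  intros Hu Hv F HF.
  apply Rle_trans with
    (rsum (fun x => 2 * a ^ 2 * u x ^ 2 + 2 * b ^ 2 * v x ^ 2)%R F).
  - apply rsum_le. intros x _. pose proof (pow2_ge_0 (a * u x - b * v x)). nra.
  - rewrite (rsum_lin G (2 * a ^ 2) (2 * b ^ 2) (fun x => u x ^ 2)%R (fun x => v x ^ 2)%R).
    apply Rplus_le_compat; apply Rmult_le_compat_l; auto; pose proof (pow2_ge_0 a);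
      pose proof (pow2_ge_0 b); lra.
Qed.

Lemma normsq_le_comp v r (f : G -> G) : Injective f ->
  normsq_le v r -> normsq_le (fun x => v (f x)) r.
Proof.
  intros Hf Hv F HF. rewrite <- (rsum_map _ _ (fun y => v y ^ 2)%R f).
  apply Hv. apply Injective_map_NoDup; auto.
Qed.

Lemma normsq_le_pt v r x : normsq_le v r -> (v x ^ 2 <= r)%R.
Proof.
  intros Hv. specialize (Hv (x :: nil)). simpl in *. rewrite Rplus_0_r in Hv.
  apply Hv. constructor; [intros [] | constructor].
Qed.

Definition delta x : R := if eq_dec_classic x (gone G) then 1%R else 0%R.

Lemma delta_normsq : normsq_le delta 1.
Proof.
  intros F HF. induction HF as [| x F Hx HF IH]; [simpl; lra |].
  change (delta x ^ 2 + rsum (fun x => delta x ^ 2) F <= 1)%R.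
  unfold delta at 1. destruct (eq_dec_classic x (gone G)) as [-> | Hne]; [| lra].
  rewrite rsum_zero; [lra |]. intros y Hy. unfold delta.
  destruct (eq_dec_classic y (gone G)) as [-> | _]; [contradiction | lra].
Qed.

(** [v] is constant on the class of [x]; an infinite class would make the sum of its squares
    unbounded. *)
Lemma class_function_supp v r x :
  normsq_le v r -> (forall g y, v (g * y * g^-1) = v y) -> v x <> 0%R -> fc G x.
Proof.
  intros Hr Hcl Hx. apply NNPP. intros Hinf.
  assert (Hlist : forall n, exists F, NoDup F /\ length F = n /\
            forall y, In y F -> conj_class G x y).
  { induction n as [| n [F [H1 [H2 H3]]]].
    - exists nil. repeat split; [constructor | intros y []].
    - apply NNPP. intros Hno. apply Hinf. exists F. intros y Hy.
      apply NNPP. intros HyF. apply Hno. exists (y :: F). repeat split.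
      + constructor; auto.
      + simpl. auto.
      + intros z [<- | Hz]; auto. }
  assert (Hx2 : (0 < v x ^ 2)%R) by nra.
  destruct (INR_unbounded (r / v x ^ 2)) as [n Hn].
  destruct (Hlist n) as [F [H1 [H2 H3]]]. specialize (Hr F H1).
  rewrite (rsum_ext _ _ (fun _ => v x ^ 2)%R), rsum_const, H2 in Hr.
  - apply (Rmult_lt_compat_r (v x ^ 2)) in Hn; auto.
    replace (r / v x ^ 2 * v x ^ 2)%R with r in Hn by (field; auto). lra.
  - intros y Hy. destruct (H3 y Hy) as [g ->]. rewrite Hcl. auto.
Qed.

(** * The annihilated functions and their distance to the point mass *)

Variable K : list G.

Definition annihilated v : Prop :=
  (exists r, normsq_le v r) /\
  forall g h, rsum (fun k => v (g * k * h)) K = 0%R.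

Lemma annihilated_lin u v (a b : R) : annihilated u -> annihilated v ->
  annihilated (fun x => a * u x + b * v x)%R.
Proof.
  intros [[r Hr] Hu] [[s Hs] Hv]. split.
  - eexists. apply normsq_le_lin; eauto.
  - intros g h. rewrite (rsum_lin G a b (fun k => u (g * k * h))), Hu, Hv. ring.
Qed.

Lemma annihilated_translate v g h :
  annihilated v -> annihilated (fun x => v (g * x * h)).
Proof.
  intros [[r Hr] Hv]. split.
  - exists r. apply (normsq_le_comp v r (fun x => g * x * h)); auto.
    intros x y H. apply gmulIr, gmulI in H. auto.
  - intros g' h'. rewrite <- (Hv (g * g') (h' * h)). apply rsum_ext.
    intros k _. rewrite !gmulA. auto.
Qed.

(** [r] bounds the squared distance from [delta] to some annihilated function; differences are
    written as linear combinations to match [normsq_le_lin]. *)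
Definition distance_le (r : R) : Prop :=
  exists v, annihilated v /\ normsq_le (fun x => 1 * delta x + (-1) * v x)%R r.

Lemma annihilated_parallelogram (d r s : R) u v :
  (forall t, distance_le t -> (d <= t)%R) -> annihilated u -> annihilated v ->
  normsq_le (fun x => 1 * delta x + (-1) * u x)%R r ->
  normsq_le (fun x => 1 * delta x + (-1) * v x)%R s ->
  normsq_le (fun x => u x - v x)%R (2 * r + 2 * s - 4 * d)%R.
Proof.
  intros Hd Hu Hv Hr Hs F HF. apply le_epsilon. intros eps Heps.
  (* The midpoint [w] is annihilated, so its squared distance to [delta] is at least [d], up to
     [eps] on a finite [F0]. The parallelogram identity is then summed over a set containing both
     [F] and [F0]. *)
  set (w := fun x => (1 / 2 * u x + 1 / 2 * v x)%R).
  assert (HF0 : exists F0, NoDup F0 /\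
    (d - eps / 4 < rsum (fun x => (1 * delta x + (-1) * w x) ^ 2) F0)%R).
  { apply NNPP. intros Hno.
    assert (Hle : (d <= d - eps / 4)%R); [| lra]. apply Hd. exists w. split.
    - apply annihilated_lin; auto.
    - intros F0 HF0. apply Rnot_lt_le. intros Hlt. apply Hno. exists F0. auto. }
  destruct HF0 as [F0 [HF0 Hlt]].
  set (F1 := nodup eq_dec_classic (F ++ F0)).
  assert (HF1 : NoDup F1) by apply NoDup_nodup.
  specialize (Hr F1 HF1). specialize (Hs F1 HF1).
  assert (H0 : (rsum (fun x => (1 * delta x + (-1) * w x) ^ 2) F0
                <= rsum (fun x => (1 * delta x + (-1) * w x) ^ 2) F1)%R).
  { apply rsum_incl; auto; [intros; apply pow2_ge_0 |].
    intros x Hx. apply nodup_In, in_app_iff. auto. }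
  assert (H1 : (rsum (fun x => (u x - v x) ^ 2) F <= rsum (fun x => (u x - v x) ^ 2) F1)%R).
  { apply rsum_incl; auto; [intros; apply pow2_ge_0 |].
    intros x Hx. apply nodup_In, in_app_iff. auto. }
  assert (H2 : rsum (fun x => (u x - v x) ^ 2)%R F1 =
    (2 * rsum (fun x => (1 * delta x + (-1) * u x) ^ 2) F1
     + 1 * (2 * rsum (fun x => (1 * delta x + (-1) * v x) ^ 2) F1
     + (-4) * rsum (fun x => (1 * delta x + (-1) * w x) ^ 2) F1))%R).
  { rewrite <- !rsum_lin. apply rsum_ext. intros x _. unfold w. field. }
  lra.
Qed.

(** A minimizing sequence is pointwise Cauchy by the parallelogram bound. Pointwise limits are
    enough, since the norm bound and the equations involve finite sums only. *)
Lemma annihilated_closest (d : R) :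
  (forall t, distance_le t -> (d <= t)%R) ->
  (forall eps, (0 < eps)%R -> exists r, distance_le r /\ (r < d + eps)%R) ->
  exists p, annihilated p /\ normsq_le (fun x => 1 * delta x + (-1) * p x)%R d.
Proof.
  intros Hd Hd'.
  assert (Hinv : forall n, (0 < / INR (S n))%R).
  { intros n. apply Rinv_0_lt_compat, lt_0_INR. lia. }
  assert (Hseq : forall n, exists v, annihilated v /\
     normsq_le (fun x => 1 * delta x + (-1) * v x)%R (d + / INR (S n))%R).
  { intros n. destruct (Hd' _ (Hinv n)) as [r [[v [Hv Hvr]] Hr]]. exists v. split; auto.
    intros F HF. specialize (Hvr F HF). lra. }
  pose (v n := proj1_sig (constructive_indefinite_description _ (Hseq n))).
  assert (Hv : forall n, annihilated (v n) /\
     normsq_le (fun x => 1 * delta x + (-1) * v n x)%R (d + / INR (S n))%R).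
  { intros n. apply (proj2_sig (constructive_indefinite_description _ (Hseq n))). }
  clearbody v.
  assert (Hlim : forall x, is_lim_seq (fun n => v n x) (real (Lim_seq (fun n => v n x)))).
  { intros x. apply Lim_seq_correct', ex_lim_seq_cauchy_corr. intros eps.
    (* For [n] and [m] at least [N] the parallelogram bound is at most [4 / INR (S N)]. *)
    destruct (INR_unbounded (4 / eps ^ 2)) as [N HN]. exists N. intros n m Hn Hm.
    destruct (Hv n) as [Hn1 Hn2], (Hv m) as [Hm1 Hm2].
    pose proof (annihilated_parallelogram d _ _ _ _ Hd Hn1 Hm1 Hn2 Hm2) as Hnm.
    apply (normsq_le_pt _ _ x) in Hnm.
    assert (He : (0 < eps ^ 2)%R) by (pose proof (cond_pos eps); nra).
    assert (HNpos : (0 < INR (S N))%R) by (apply lt_0_INR; lia).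
    assert (HN' : (4 * / INR (S N) < eps ^ 2)%R).
    { apply (Rmult_lt_reg_r (INR (S N))); auto.
      rewrite Rmult_assoc, Rinv_l, Rmult_1_r by lra. rewrite S_INR.
      apply (Rmult_lt_compat_r (eps ^ 2)) in HN; auto. unfold Rdiv in HN.
      rewrite Rmult_assoc, Rinv_l in HN by lra. lra. }
    assert (Hle : forall k, (N <= k)%nat -> (/ INR (S k) <= / INR (S N))%R).
    { intros k Hk. apply Rinv_le_contravar; auto. apply le_INR. lia. }
    pose proof (Hle n Hn). pose proof (Hle m Hm).
    rewrite <- (Rabs_pos_eq eps) by apply Rlt_le, cond_pos.
    apply Rsqr_lt_abs_0. rewrite !Rsqr_pow2. cbv beta in Hnm. lra. }
  set (p := fun x => real (Lim_seq (fun n => v n x))) in *.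
  assert (Hp : normsq_le (fun x => 1 * delta x + (-1) * p x)%R d).
  { intros F HF.
    apply (is_lim_seq_le
      (fun n => rsum (fun x => (1 * delta x + (-1) * v n x) ^ 2)%R F)
      (fun n => (d + / INR (S n))%R)
      (rsum (fun x => (1 * delta x + (-1) * p x) ^ 2)%R F) d).
    - intros n. apply (Hv n). auto.
    - apply (is_lim_seq_rsum _ (fun n x => (1 * delta x + (-1) * v n x) ^ 2)%R
        (fun x => (1 * delta x + (-1) * p x) ^ 2)%R). intros x.
      assert (Hx : is_lim_seq (fun n => (1 * delta x + (-1) * v n x)%R)
                     (1 * delta x + (-1) * p x)%R).
      { apply is_lim_seq_plus'; [apply is_lim_seq_const |].
        apply (is_lim_seq_scal_l _ (-1) (p x)). apply Hlim. }
      simpl. apply (is_lim_seq_mult' _ _ _ _ Hx).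
      apply (is_lim_seq_mult' _ _ _ _ Hx). apply is_lim_seq_const.
    - apply is_lim_seq_add_inv. }
  exists p. split; auto. split.
  - exists (2 * 1 ^ 2 * 1 + 2 * (-1) ^ 2 * d)%R. intros F HF.
    rewrite (rsum_ext _ _
      (fun x => (1 * delta x + (-1) * (1 * delta x + (-1) * p x)) ^ 2)%R).
    + apply (normsq_le_lin _ _ _ _ _ _ delta_normsq Hp F HF).
    + intros. ring.
  - intros g h.
    assert (H : is_lim_seq (fun n => rsum (fun k => v n (g * k * h)) K)
                  (rsum (fun k => p (g * k * h)) K)).
    { apply (is_lim_seq_rsum _ (fun n k => v n (g * k * h))). intros k. apply Hlim. }
    apply (is_lim_seq_ext _ (fun _ => 0%R)) in H.
    + apply is_lim_seq_unique in H. rewrite Lim_seq_const in H. congruence.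
    + intros n. apply (Hv n).
Qed.

(** Translate [f] so that its value [a] at the identity is nonzero. A multiple [t] of it has squared
    distance at most [1 - 2 * t * a + t ^ 2 * M] from [delta], below 1 for [t = a / (2 * M)]. *)
Lemma annihilated_near_delta f x0 : annihilated f -> f x0 <> 0%R ->
  exists r, distance_le r /\ (r < 1)%R.
Proof.
  intros Hf Hx0. apply (annihilated_translate f x0 (gone G)) in Hf.
  set (f1 := fun x => f (x0 * x * gone G)) in Hf.
  assert (Ha : f1 (gone G) <> 0%R) by (unfold f1; rewrite !gmul1r; auto).
  set (a := f1 (gone G)) in Ha. destruct (proj1 Hf) as [M HM].
  assert (HaM : (a ^ 2 <= M)%R) by (apply normsq_le_pt; auto).
  assert (Ha2 : (0 < a ^ 2)%R) by nra.
  set (t := (a / (2 * M))%R). set (c := (a ^ 2 / M)%R).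
  assert (Hta : (2 * t * a = c)%R) by (unfold t, c; field; lra).
  assert (HtM : (t ^ 2 * M = c / 4)%R) by (unfold t, c; field; lra).
  assert (Hc : (0 < c <= 1)%R).
  { unfold c. split; [apply Rdiv_lt_0_compat; lra |].
    apply Rmult_le_reg_r with M; [lra |]. field_simplify; lra. }
  exists (1 - c + c / 4)%R. split; [| lra].
  exists (fun x => t * f1 x + 0 * f1 x)%R. split; [apply annihilated_lin; auto |].
  intros F HF.
  rewrite (rsum_ext _ _ (fun x => (1 - c) * delta x ^ 2 + t ^ 2 * f1 x ^ 2)%R).
  - rewrite (rsum_lin G (1 - c) (t ^ 2) (fun x => delta x ^ 2)%R (fun x => f1 x ^ 2)%R).
    pose proof (delta_normsq F HF). specialize (HM F HF).
    apply (Rmult_le_compat_l (t ^ 2)) in HM; [| apply pow2_ge_0]. nra.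
  - intros x _. rewrite <- Hta. unfold delta.
    destruct (eq_dec_classic x (gone G)) as [-> | _]; [fold a |]; ring.
Qed.

Lemma annihilated_trivial :
  no_nontrivial_finite_normal G -> K <> nil -> NoDup K ->
  forall f, annihilated f -> forall x, f x = 0%R.
Proof.
  intros HG HK0 HK f Hf x0. apply NNPP. intros Hx0.
  destruct (annihilated_near_delta f x0 Hf Hx0) as [r0 [Hr0 Hr01]].
  destruct (infimum distance_le 0) as [d [Hd Hd']].
  { exists r0. auto. }
  { intros r [v [_ Hv]]. apply (Hv nil). constructor. }
  destruct (annihilated_closest d Hd Hd') as [p [Hp Hpd]].
  (* Conjugation fixes [delta] and preserves the annihilated functions, so the conjugate of [p] is
     also closest; the parallelogram bound with both distances [d] is 0. *)
  assert (Hcl : forall g y, p (g * y * g^-1) = p y).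
  { intros g y.
    assert (Hpg : normsq_le (fun x => 1 * delta x + (-1) * p (g * x * g^-1)%g)%R d).
    { intros F HF.
      rewrite (rsum_ext _ _
        (fun x => (1 * delta (g * x * g^-1)%g + (-1) * p (g * x * g^-1)%g) ^ 2)%R).
      - apply (normsq_le_comp _ d (fun x => g * x * g^-1)) in Hpd; auto.
        intros a b H. apply gmulIr, gmulI in H. auto.
      - intros x _. unfold delta.
        destruct (eq_dec_classic x (gone G)) as [-> | Hne],
          (eq_dec_classic (g * _ * g^-1) (gone G)) as [e | e]; auto; exfalso.
        + apply e. rewrite gmul1r. apply gmulVr.
        + apply Hne. apply (gmulI G g), (gmulIr G (g^-1)). rewrite e, gmul1r.
          symmetry. apply gmulVr. }
    pose proof (annihilated_parallelogram d d d _ _ Hd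
      (annihilated_translate p g (g^-1) Hp) Hp Hpg Hpd) as H.
    apply (normsq_le_pt _ _ y) in H. simpl in H. nra. }
  destruct (proj1 Hp) as [M HM].
  assert (Hsupp : forall x, p x <> 0%R -> fc G x).
  { intros x. apply (class_function_supp p M); auto. }
  (* If [p] vanished, its squared distance to [delta] would be at least 1, while [d <= r0 < 1]. *)
  assert (Hx1 : exists x1, p x1 <> 0%R).
  { apply NNPP. intros Hno. specialize (Hd r0 Hr0).
    apply (normsq_le_pt _ _ (gone G)) in Hpd. unfold delta in Hpd.
    destruct (eq_dec_classic (gone G) (gone G)); [| congruence].
    replace (p (gone G)) with 0%R in Hpd; [lra |].
    apply NNPP. intros H. apply Hno. exists (gone G). auto. }
  destruct Hx1 as [x1 Hx1]. destruct K as [| k0 K'] eqn:EK; [congruence |].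
  rewrite <- EK in *.
  (* Translating [K] by [k0^-1] brings the identity into it, so its intersection with the FC-centre
     is nonempty. *)
  pose (L := filter (fun l => if excluded_middle_informative (fc G l) then true else false)
               (map (fun k => k0^-1 * k) K)).
  assert (HL : forall l, In l L <-> In l (map (fun k => k0^-1 * k) K) /\ fc G l).
  { intros l. unfold L. rewrite filter_In.
    destruct (excluded_middle_informative (fc G l)); intuition discriminate. }
  apply Hx1. rewrite <- (gmul1r G x1).
  apply (abelian_pompeiu G (fc G)) with (L := L) (M := M) (q := fun y => p (x1 * y)).
  - split; [apply fc_one | split; [apply fc_mul | apply fc_inv]].
  - intros x y Hx Hy. apply fc_commute; auto.
  - intros x n Hx. apply fc_torsion_free; auto.
  - intros HLnil. apply (in_nil (a := gone G)). rewrite <- HLnil. apply HL. split.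
    + apply in_map_iff. exists k0. split; [apply gmulV |]. rewrite EK. left. auto.
    + apply fc_one.
  - apply NoDup_filter. apply Injective_map_NoDup; auto. intros x y H.
    apply gmulI in H. auto.
  - intros l Hl. apply HL in Hl. tauto.
  - apply (normsq_le_comp p M (fun y => x1 * y)); auto.
    intros x y H. apply gmulI in H. auto.
  (* This is the equation for [K] at [x1 * d' * k0^-1] and the identity. The discarded terms vanish:
     if [p] is nonzero at [x1 * (d' * l)], that point is in the FC-centre, and so is [l]. *)
  - intros d' Hd''. unfold L. rewrite rsum_filter.
    + rewrite rsum_map, <- (proj2 Hp (x1 * d' * k0^-1) (gone G)).
      apply rsum_ext. intros k _. rewrite gmul1r, <- !gmulA. auto.
    + intros l Hl. apply NNPP. intros Hpl. apply Hsupp in Hpl.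
      destruct (excluded_middle_informative (fc G l)) as [| Hn]; [discriminate |].
      apply Hn. replace l with ((x1 * d')^-1 * (x1 * (d' * l))).
      * apply fc_mul; auto. apply fc_inv, fc_mul; auto.
      * rewrite (gmulA x1), gmulVK. auto.
Qed.

End SquareSummable.

(** * From complex to real functions *)

Lemma ell2_bounded (G : Group) (xi : G -> C) : ell2 xi ->
  exists M, forall F, NoDup F -> rsum (fun x => Cmod (xi x) ^ 2) F <= M.
Proof.
  (* Sums over sets containing [F0] are within 1 of [r]; any other finite set is first enlarged by
     [F0], the terms being nonnegative. *)
  intros [r Hr]. destruct (Hr 1 Rlt_0_1) as [F0 HF0]. exists (r + 1). intros F HF.
  set (F1 := nodup eq_dec_classic (F ++ F0)).
  apply Rle_trans with (rsum (fun x => Cmod (xi x) ^ 2) F1).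
  { apply rsum_incl; auto; [intros; apply pow2_ge_0 |].
    intros x Hx. apply nodup_In, in_app_iff. auto. }
  assert (Hincl : incl F0 F1) by (intros x Hx; apply nodup_In, in_app_iff; auto).
  specialize (HF0 F1 (NoDup_nodup _ _) Hincl).
  assert (Hsum : csum (fun x => RtoC (Cmod (xi x) ^ 2)) F1
                 = RtoC (rsum (fun x => Cmod (xi x) ^ 2) F1)).
  { clear. induction F1 as [| x F1 IH]; auto.
    unfold csum, rsum in *. cbn [fold_right]. rewrite RtoC_plus, IH. auto. }
  rewrite Hsum, <- RtoC_minus, Cmod_R in HF0.
  apply Rabs_def2 in HF0. lra.
Qed.

Lemma chi1_ell2 (G : Group) : ell2 (@chi1 G).
Proof.
  exists 1. intros eps Heps. exists (gone G :: nil). intros F HF Hin.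
  replace (csum (fun x => RtoC (Cmod (chi1 x) ^ 2)) F) with (RtoC 1).
  { replace (Cminus (RtoC 1) (RtoC 1)) with (RtoC 0) by ring. rewrite Cmod_0. auto. }
  assert (H1 : In (gone G) F) by (apply Hin; left; auto). clear Hin.
  assert (Hout : forall F, ~ In (gone G) F ->
    csum (fun x : G => RtoC (Cmod (chi1 x) ^ 2)) F = RtoC 0).
  { induction F0 as [| x F0 IH]; intros Hx; auto.
    change (Cplus (RtoC (Cmod (chi1 x) ^ 2)) (csum (fun x => RtoC (Cmod (chi1 x) ^ 2)) F0)
      = RtoC 0).
    rewrite IH by (intros H; apply Hx; right; auto). unfold chi1.
    destruct (excluded_middle_informative (x = gone G)) as [-> | _];
      [exfalso; apply Hx; left; auto |].
    rewrite Cmod_0. replace (0 ^ 2)%R with 0%R by ring. ring. }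
  induction HF as [| x F Hx HF IH]; [destruct H1 |].
  change (RtoC 1 = Cplus (RtoC (Cmod (chi1 x) ^ 2))
    (csum (fun x => RtoC (Cmod (chi1 x) ^ 2)) F)).
  destruct (classic (x = gone G)) as [-> | Hne].
  - rewrite Hout by auto. unfold chi1.
    destruct (excluded_middle_informative (gone G = gone G)); [| congruence].
    rewrite Cmod_1. replace (1 ^ 2)%R with 1%R by ring. ring.
  - destruct H1 as [H1 | H1]; [congruence |]. rewrite <- IH by auto. unfold chi1.
    destruct (excluded_middle_informative (x = gone G)); [congruence |].
    rewrite Cmod_0. replace (0 ^ 2)%R with 0%R by ring. ring.
Qed.

Theorem theorem4p3 (G : Group) :
  finitely_generated G -> no_nontrivial_finite_normal G ->
  pompeiu_group (@in_NG G).
Proof.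
  intros _ HG K HK0 HK f [T [[HT _] [_ ->]]] Hsum.
  specialize (HT _ (@chi1_ell2 G)). set (f := T (@chi1 G)) in *.
  destruct (ell2_bounded G f HT) as [M HM].
  assert (Hmod : forall z : C, Cmod z ^ 2 = fst z ^ 2 + snd z ^ 2).
  { intros z. unfold Cmod. rewrite pow2_sqrt; auto.
    apply Rplus_le_le_0_compat; apply pow2_ge_0. }
  (* Real and imaginary parts are treated together: each is additive and bounded by the modulus, so
     it turns [f] into a real annihilated function. *)
  assert (Hpart : forall part : C -> R, (forall z, part z ^ 2 <= Cmod z ^ 2) ->
    part (RtoC 0) = 0 -> (forall z z', part (Cplus z z') = part z + part z') ->
    forall x, part (f x) = 0).
  { intros part Hle H0 Hadd.
    apply (annihilated_trivial G K HG HK0 HK (fun x => part (f x))). split.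
    - exists M. intros F HF. eapply Rle_trans; [apply rsum_le | apply HM; eauto].
      intros x _. apply Hle.
    - intros g h. rewrite <- H0, <- (Hsum g h). clear HK0 HK Hsum.
      induction K as [| k K' IH]; [symmetry; apply H0 |].
      change (part (f (gmul (gmul g k) h)) +
        rsum (fun k => part (f (gmul (gmul g k) h))) K' =
        part (Cplus (f (gmul (gmul g k) h))
          (csum f (map (fun k => gmul (gmul g k) h) K')))).
      rewrite Hadd, IH. auto. }
  apply FunctionalExtensionality.functional_extensionality. intros x.
  apply injective_projections; apply Hpart; auto; intros z; rewrite Hmod;
    pose proof (pow2_ge_0 (fst z)); pose proof (pow2_ge_0 (snd z)); lra.
Qed.
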